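(* For every $n\ge1$, $$\mathrm{SH}_n=\sum_{\substack{\lambda\vdash n\\ \text{all parts odd}}}\frac{2^{\ell}}{\ell!}\cdot\frac{\ell!}{m_1!\,m_3!\,m_5!\cdots}\cdot\prod_{j=0}^{\ell-2}(n+\ell-1-2j)\;V_\lambda,$$ where $\ell=\ell(\lambda)$ is the number of parts of $\lambda$, $m_i$ is the number of parts equal to $i$, the product $\prod_{j=0}^{\ell-2}(n+\ell-1-2j)=(n+\ell-1)(n+\ell-3)\cdots(n-\ell+3)$ is empty (equal to $1$) when $\ell=1$, and $V_\lambda=P_{\lambda_1}P_{\lambda_2}\cdots$.
   Context: Work in the ring $\Lambda_{\mathbb Q}$ of symmetric functions with rational coefficients in variables $x=(x_1,x_2,\dots)$; $p_k$ denotes the power sum. For $f\in\Lambda_{\mathbb Q}$, its shiftification $f(x/x)$ is obtained by writing $f$ as a polynomial in the power sums and substituting $p_{2i+1}\mapsto 2p_{2i+1}$ and $p_{2i}\mapsto 0$ for all $i\ge1$. A parking function of length $n$ is a sequence $(a_1,\dots,a_n)$ of positive integers whose weakly increasing rearrangement $b_1\le\cdots\le b_n$ satisfies $b_i\le i$ for all $i$. The symmetric group $S_n$ acts on the set of parking functions of length $n$ by permuting coordinates; $\mathrm{PF}_n$ denotes the Frobenius characteristic of this permutation representation ($\mathrm{PF}_0=1$). Define $\mathrm{SH}_n(x)=\mathrm{PF}_n(x/x)$. The one-row Schur $P$-functions $P_n$ are defined by $1+2\sum_{n\ge1}P_n(x)t^n=\prod_i\frac{1+x_it}{1-x_it}$.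 For any partition $\lambda$, $V_\lambda=P_{\lambda_1}P_{\lambda_2}\cdots$. (The $P_{2i+1}$, $i\ge0$, are algebraically independent and generate $\Gamma=\mathbb Q[p_1,p_3,p_5,\dots]$, so this expansion is unique.) *)

(* Defs.v *)
From HB Require Import structures.
From mathcomp Require Import all_boot all_order all_algebra all_fingroup.
From mathcomp.multinomials Require Import mpoly.
Set Implicit Arguments. Unset Strict Implicit. Unset Printing Implicit Defensive.
Import Order.TTheory GRing.Theory Num.Theory.
Local Open Scope ring_scope.

(* Model of Lambda_Q in degrees <= n: Lambda_Q = Q[p_1, p_2, ...] (the power
   sums are algebraically independent generators); every symmetric function
   of degree <= n lies in Q[p_1,...,p_n] = {mpoly rat[n]}, where the
   variable 'X_i stands for the power sum p_(i+1). *)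

(* p_k as an element of Q[p_1..p_n] (k must satisfy 1 <= k <= n). *)
Definition psum (n k : nat) : {mpoly rat[n]} := \sum_(i < n | i.+1 == k) 'X_i.

(* Parking functions of length n: a_i = (f i) + 1 with f i in {0..n-1}
   (a parking function automatically has all entries <= n).  The condition
   b_i <= i (1-indexed) on the increasing rearrangement b becomes
   c_i <= i (0-indexed) for c = sorted (a - 1). *)
Definition is_parking (n : nat) (f : {ffun 'I_n -> 'I_n}) : bool :=
  let s := sort leq [seq val (f i) | i <- enum 'I_n] in
  [forall i : 'I_n, nth 0%N s i <= i]%N.

(* Character of the permutation action of S_n on parking functions
   (coordinate permutation): number of parking functions fixed by s. *)
Definition pf_char (n : nat) (s : 'S_n) : nat :=
  #|[set f : {ffun 'I_n -> 'I_n} | is_parking f & [forall i, f (s i) == f i]]|.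

Definition p_cycle_type (n : nat) (s : 'S_n) : {mpoly rat[n]} :=
  \prod_(C in porbits s) psum n #|C|.

(* Frobenius characteristic: (1/n!) sum_s chi(s) p_{cycle type(s)}. *)
Definition PF (n : nat) : {mpoly rat[n]} :=
  (n`!%:R : rat)^-1 *: \sum_(s : 'S_n) ((pf_char s)%:R : rat) *: p_cycle_type s.

Definition shift_subst (n : nat) : n.-tuple {mpoly rat[n]} :=
  [tuple (if odd i.+1 then (2%:R : rat) *: 'X_i else 0) | i < n].

Definition SH (n : nat) : {mpoly rat[n]} := PF n \mPo shift_subst n.

Definition ev_vars (n N : nat) : n.-tuple {mpoly rat[N]} :=
  [tuple \sum_(j < N) 'X_j ^+ i.+1 | i < n].

(* Coefficient of t^m in prod_{i<=N} (1 + x_i t) / (1 - x_i t), computed by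
   truncating 1/(1 - x_i t) at order m (which does not affect t^m). *)
Definition gen_coef (N m : nat) : {mpoly rat[N]} :=
  (\prod_(i < N) ((1 + ('X_i)%:P * 'X) *
                  \sum_(j < m.+1) (('X_i : {mpoly rat[N]})%:P * 'X) ^+ j))`_m.

(* P : nat -> Q[p_1..p_n] gives the one-row Schur P-functions P_1..P_n:
   1 + 2 sum_m P_m t^m = prod_i (1 + x_i t)/(1 - x_i t), checked in every
   finite number N of variables (this determines P_m uniquely). *)
Definition is_schurP_family (n : nat) (P : nat -> {mpoly rat[n]}) : Prop :=
  forall m N : nat, (1 <= m <= n)%N ->
    (2%:R : rat) *: (P m \mPo ev_vars n N) = gen_coef N m.

(* Partitions of n with all parts odd, encoded by multiplicity vectors
   mu i = m_i (number of parts equal to i), i in {0..n}. *)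
Definition odd_partition_mult (n : nat) (mu : {ffun 'I_n.+1 -> 'I_n.+1}) : bool :=
  [forall i : 'I_n.+1, ~~ odd i ==> (val (mu i) == 0%N)] &&
  (\sum_(i < n.+1) i * mu i == n)%N.

Definition plength (n : nat) (mu : {ffun 'I_n.+1 -> 'I_n.+1}) : nat :=
  (\sum_(i < n.+1) mu i)%N.

Definition Vlam (n : nat) (P : nat -> {mpoly rat[n]})
  (mu : {ffun 'I_n.+1 -> 'I_n.+1}) : {mpoly rat[n]} :=
  \prod_(i < n.+1) P i ^+ mu i.

Definition coef_lam (n : nat) (mu : {ffun 'I_n.+1 -> 'I_n.+1}) : rat :=
  let l := plength mu in
  (2%:R ^+ l / (l`!)%:R) * ((l`!)%:R / (\prod_(i < n.+1) (mu i)`!)%:R) *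
  \prod_(j < l.-1) ((n + l)%:R - 1 - 2%:R * j%:R).

(* Main.v *)
Require Import Defs.
From HB Require Import structures.
From mathcomp Require Import all_boot all_order all_algebra all_fingroup.
From mathcomp.multinomials Require Import mpoly.
From mathcomp Require Import zify ring.
Set Implicit Arguments. Unset Strict Implicit. Unset Printing Implicit Defensive.
Import Order.TTheory GRing.Theory Num.Theory.
Local Open Scope ring_scope.

(* Pollak's circle argument gives (n+1) chi(s) = (n+1)^(number of cycles of s)
   for the parking character chi, so (n+1) PF_n is the cycle index of S_n
   evaluated at (n+1) p_k, that is the t^n coefficient of
   exp((n+1) sum_k p_k t^k / k).  After shiftification,
   (n+1) SH_n = [t^n] Q(t)^(n+1) with Q = exp(sum_(k odd) 2 p_k t^k / k)
   = 1 + 2 sum_m P_m t^m.  Since Q(t) Q(-t) = 1, the even and odd parts of Q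
   satisfy E^2 = 1 + O^2, hence Q^(n+1) = (O + sqrt(1 + O^2))^(n+1), and the
   theorem is the Taylor expansion of (u + sqrt(1 + u^2))^(n+1) at u = O,
   O = 2 sum_(m odd) P_m t^m.  Exponential series are handled through the
   linear differential equations that characterise them modulo powers of t;
   identities between symmetric functions are checked on variables, which is
   legitimate because the power sums are algebraically independent. *)

(** * Algebraic independence of the power sums *)

(** The polynomials obeying the chain rule contain 1 and the variables and are closed under products
    and linear combinations, hence are all polynomials. *)
Lemma mderiv_comp_mpoly (R : comNzRingType) (n k : nat)
    (lq : n.-tuple {mpoly R[k]}) (j : 'I_k) (p : {mpoly R[n]}) :
  (p \mPo lq)^`M(j) = \sum_(i < n) (p^`M(i) \mPo lq) * (tnth lq i)^`M(j).
Proof.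
pose chain (q : {mpoly R[n]}) :=
  (q \mPo lq)^`M(j) = \sum_(i < n) (q^`M(i) \mPo lq) * (tnth lq i)^`M(j).
have chainM q r : chain q -> chain r -> chain (q * r).
  rewrite /chain => hq hr; rewrite rmorphM /= mderivM hq hr.
  rewrite mulr_suml mulr_sumr -big_split /=; apply: eq_bigr => i _.
  by rewrite mderivM comp_mpolyD !rmorphM /=; ring.
have chain1 : chain 1.
  rewrite /chain comp_mpoly1 -[1]/(1%:MP) mderivC big1 // => i _.
  by rewrite -[1]/(1%:MP) mderivC comp_mpoly0 mul0r.
have chainX i : chain 'X_i.
  rewrite /chain comp_mpolyXU -tnth_nth (bigD1 i) //= big1 => [|l ne_li].
    have -> : (mderiv i 'X_i : {mpoly R[n]}) = 1.
      rewrite mderivX mnmE eqxx scale1r -{1}[U_(i)%MM]add0m addmK.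
      exact: mpolyX0.
    by rewrite addr0 comp_mpoly1 mul1r.
  by rewrite mderivX mnmE eq_sym (negbTE ne_li) scale0r comp_mpoly0 mul0r.
elim/mpolyind: p => [|c m p _ _ IHp].
  rewrite comp_mpoly0 mderiv0 big1 // => i _.
  by rewrite mderiv0 comp_mpoly0 mul0r.
have chainXm : chain 'X_[m].
  rewrite mpolyXE_id; apply: (big_ind chain) => // i _.
  by elim: (m i) => [|e IHe]; rewrite ?expr0 // exprS; apply: chainM.
rewrite comp_mpolyD comp_mpolyZ mderivD mderivZ chainXm IHp scaler_sumr.
rewrite -big_split /=; apply: eq_bigr => i _.
by rewrite mderivD mderivZ comp_mpolyD comp_mpolyZ mulrDl scalerAl.
Qed.

Lemma msize_mderiv (n : nat) (i : 'I_n) (p : {mpoly rat[n]}) (k : nat) :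
  (msize p <= k.+1)%N -> (msize p^`M(i) <= k)%N.
Proof.
move=> le_p; rewrite msizeE; apply/bigmax_leqP_seq => m supp_m _.
suff /msize_mdeg_lt: (m + U_(i))%MM \in msupp p.
  by rewrite mdegD mdeg1 addn1 => /leq_trans/(_ le_p).
move: supp_m; rewrite !mcoeff_msupp mcoeff_deriv.
by apply: contraNneq => ->; rewrite mul0rn.
Qed.

(** In characteristic zero, a monomial [m] with [m i] nonzero survives in the i-th derivative with
    its coefficient multiplied by [m i]. *)
Lemma mderiv_eq0_const (n : nat) (p : {mpoly rat[n]}) :
  (forall i, p^`M(i) = 0) -> p = (p@_0)%:MP.
Proof.
move=> dp0; apply/mpolyP => m; rewrite mcoeffC.
have [->|nz_m] := eqVneq m 0%MM; first by rewrite mulr1.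
rewrite mulr0.
have [i nz_mi]: exists i, m i != 0%N.
  apply/existsP; apply: contraR nz_m; rewrite negb_exists => /forallP m0.
  by apply/eqP/mnmP => i; rewrite mnmE; apply/eqP; rewrite -[_ == _]negbK m0.
have := congr1 (mcoeff (m - U_(i))%MM) (dp0 i).
rewrite mcoeff_deriv mcoeff0 submK ?lep1mP // => /eqP.
by rewrite mulrn_eq0 /= => /eqP.
Qed.

(* Jacobian criterion: differentiating a relation f(p_1, ..., p_n) = 0 in x_j
   shows that sum_i (i+1) (d_i f)(p) T^i vanishes at the n distinct points
   T = x_j, so that every d_i f is a relation of smaller degree. *)
Lemma psum_alg_indep (n : nat) (f : {mpoly rat[n]}) :
  f \mPo ev_vars n n = 0 -> f = 0.
Proof.
elim: {f}(msize f) {-2}f (leqnn (msize f)) => [f|k IHk f le_f f0].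
  by rewrite leqn0 msize_poly_eq0 => /eqP.
suff df0 i : f^`M(i) = 0.
  rewrite (mderiv_eq0_const df0) in f0 *.
  by rewrite comp_mpolyC in f0.
apply: IHk; first exact: msize_mderiv.
have dpsum (j : 'I_n) l : (\sum_(h < n) 'X_h ^+ l.+1 : {mpoly rat[n]})^`M(j)
    = 'X_j ^+ l *+ l.+1.
  rewrite [LHS]raddf_sum /= (bigD1 j) //= big1 ?addr0 => [|h ne_hj].
    rewrite mpolyXn mderivX mulmnE mnm1E eqxx mul1n.
    have -> : (U_(j) *+ l.+1 - U_(j) = U_(j) *+ l)%MM.
      by rewrite mulmS addmC addmK.
    by rewrite -mpolyXn scaler_nat.
  rewrite mpolyXn mderivX mulmnE mnm1E (negbTE ne_hj).
  by rewrite mul0n scale0r.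
pose g := \poly_(i < n) (if insub i is Some i then
   (f^`M(i) \mPo ev_vars n n) *+ i.+1 else 0) : {poly {mpoly rat[n]}}.
have gE (l : 'I_n) : g`_l = (f^`M(l) \mPo ev_vars n n) *+ l.+1.
  by rewrite coef_poly ltn_ord valK.
have g0 : g = 0.
  apply/eqP/negPn/negP => nz_g.
  have := @max_poly_roots _ g [seq 'X_j | j <- enum 'I_n] nz_g.
  rewrite size_map size_enum_ord ltnNge size_poly => H.
  suff : false by [].
  apply: H.
    apply/allP => _ /mapP[j _ ->]; rewrite /root.
    have := congr1 (mderiv j) f0; rewrite mderiv_comp_mpoly mderiv0 => dj.
    rewrite horner_poly -[X in _ == X]dj; apply/eqP/eq_bigr => l _.
    by rewrite valK tnth_mktuple dpsum mulrnAl mulrnAr.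
  rewrite map_inj_uniq ?enum_uniq // => i1 i2 /(congr1 (mcoeff U_(i1))).
  rewrite !mcoeffX eqxx; case: eqP => // /(congr1 (fun m : 'X_{1..n} => m i1)).
  by rewrite !mnm1E eqxx; case: (eqVneq i2 i1).
have /esym/eqP := gE i.
by rewrite g0 coef0 -scaler_nat scaler_eq0 pnatr_eq0 /= => /eqP.
Qed.

(** * Permutations and contents of functions *)

(** A function fixed by [s] is a free choice of one value per cycle, which is what expanding the
    product produces. *)
Lemma prod_porbits_psum (R : comNzRingType) (T I : finType) (c0 : I)
    (s : {perm T}) (y : I -> R) :
  \prod_(C in porbits s) \sum_(c : I) y c ^+ #|C|
    = \sum_(f : {ffun T -> I} | [forall x, f (s x) == f x]) \prod_x y (f x).
Proof.
have porbit_s x : porbit s (s x) = porbit s x by rewrite (porbit_perm s 1).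
have mem_porbits x : porbit s x \in porbits s by rewrite imset_f.
rewrite (big_distr_big_dep c0).
pose h (g : {ffun {set T} -> I}) := [ffun x => g (porbit s x)].
(* The value on a cycle is read at any of its points; sets that are not cycles get the default [c0]
   that the distributivity lemma imposes. *)
pose h' (f : {ffun T -> I}) : {ffun {set T} -> I} :=
  [ffun C : {set T} => if C \in porbits s then
     (if [pick x in C] is Some x then f x else c0) else c0].
rewrite [RHS](reindex_onto h h') => [|f /forallP fs]; last first.
  apply/ffunP => x; rewrite !ffunE mem_porbits.
  case: pickP => [z /porbitP[i ->]|/(_ x)]; last by rewrite porbit_id.
  by elim: i => [|i IHi]; rewrite ?perm1 // expgSr permM (eqP (fs _)).
apply: eq_big => [g|g _].
  have -> /= : [forall x, h g (s x) == h g x].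
    by apply/forallP => x; rewrite !ffunE porbit_s.
  apply/pfamilyP/eqP => [[/supportP gs _]|<-].
    apply/ffunP => C; rewrite ffunE; case: ifPn => [|/gs->//].
    case/imsetP => x _ ->; case: pickP => [z|/(_ x)]; last by rewrite porbit_id.
    by rewrite -eq_porbit_mem ffunE => /eqP->.
  by split=> //; apply/supportP => C /negbTE nC; rewrite ffunE nC.
rewrite [RHS](partition_big (porbit s) (mem (porbits s))) //=.
apply: eq_bigr => C /imsetP[z _ ->].
rewrite (eq_bigr (fun=> y (g (porbit s z)))) => [|x /eqP Cx]; last first.
  by rewrite ffunE Cx.
rewrite prodr_const; congr (_ ^+ _); apply: eq_card => x.
by rewrite -eq_porbit_mem [in RHS]unfold_in.
Qed.

(** The exponent vector of the monomial prod_x y_(f x). *)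
Definition content (n N : nat) (f : {ffun 'I_n -> 'I_N}) (i : 'I_N) : nat :=
  (\sum_x (f x == i))%N.

Lemma content_perm (n N : nat) (f : {ffun 'I_n -> 'I_N}) (t : 'S_n) :
  content [ffun x => f (t x)] =1 content f.
Proof.
move=> i; rewrite /content [RHS](reindex_perm t) /=.
by apply: eq_bigr => x _; rewrite ffunE.
Qed.

Lemma content_count (n N : nat) (f : {ffun 'I_n -> 'I_N}) (i : 'I_N) :
  content f i = count_mem i [tuple f x | x < n].
Proof.
rewrite /= count_map -sum1_count big_mkcond /= big_enum /=.
by apply: eq_bigr => x _; case: eqP.
Qed.

Lemma eq_content_perm (n N : nat) (f g : {ffun 'I_n -> 'I_N}) :
  content f =1 content g -> exists t : 'S_n, f = [ffun x => g (t x)].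
Proof.
move=> fg; have /tuple_permP[t ft]: perm_eq [tuple f x | x < n] [tuple g x | x < n].
  by apply/allP => i _ /=; rewrite -!content_count fg.
exists t; apply/ffunP => x; rewrite ffunE.
have /val_inj/(congr1 (fun u => tnth u x)) := ft.
by rewrite !tnth_mktuple.
Qed.

Lemma content_surj (n N : nat) (a : 'I_N -> nat) :
  (\sum_i a i)%N = n -> exists f : {ffun 'I_n -> 'I_N}, content f =1 a.
Proof.
(* The witness is the word repeating each letter [i] exactly [a i] times. *)
move=> sum_a; pose u := flatten [seq nseq (a i) i | i <- enum 'I_N].
have size_u : size u == n.
  rewrite size_flatten /shape -map_comp sumnE big_map big_enum /= -[X in _ == X]sum_a.
  by apply/eqP/eq_bigr => i _ /=; rewrite size_nseq.
exists [ffun x => tnth (Tuple size_u) x] => i; rewrite content_count.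
transitivity (count_mem i u).
  congr (count_mem i _); rewrite -[RHS]/(val (Tuple size_u)); congr val.
  by apply: eq_from_tnth => x; rewrite tnth_mktuple ffunE.
rewrite count_flatten -map_comp sumnE big_map big_enum /= (bigD1 i) //= big1.
  by rewrite count_nseq /= eqxx mul1n addn0.
by move=> j ne_ji; rewrite count_nseq /= (negbTE ne_ji).
Qed.

(* Orbit-stabiliser: the functions with a given content form a single orbit. *)
Lemma sum_stab_content (n N : nat) (g : {ffun 'I_n -> 'I_N}) :
  (\sum_(f : {ffun 'I_n -> 'I_N} | [forall i, content f i == content g i])
     \sum_(s : 'S_n | [forall x, f (s x) == f x]) 1 = n`!)%N.
Proof.
rewrite -(card_Sn n) -sum1_card.
pose act (t : 'S_n) : {ffun 'I_n -> 'I_N} := [ffun x => g (t x)].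
rewrite (partition_big act
  (fun f => [forall i, content f i == content g i])) => [|t _]; last first.
  by apply/forallP => i; rewrite content_perm.
apply: eq_bigr => f /forallP fg.
have [t0 ft0] : exists t0 : 'S_n, f = [ffun x => g (t0 x)].
  by apply: eq_content_perm => i; apply/eqP.
(* Since [t0] carries [g] to [f], a permutation [s] fixes [f] exactly when [s * t0] also carries [g]
   to [f]. *)
rewrite [RHS](reindex_inj (mulIg t0)) /=; apply: eq_bigl => s.
apply/forallP/eqP => [fs|fs x].
  by apply/ffunP => x; rewrite ffunE permM -(eqP (fs x)) ft0 ffunE.
by rewrite -[in X in _ == X]fs ft0 !ffunE permM.
Qed.

(** Pairs of a permutation and a function it fixes are grouped by content, each content accounting
    for n! pairs. This is n! h_n written in power sums. *)
Lemma sum_perm_psum (R : comNzRingType) (n N : nat) (y : 'I_N.+1 -> R) :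
  \sum_(s : 'S_n) \prod_(C in porbits s) \sum_i y i ^+ #|C| =
  (\sum_(a : {ffun 'I_N.+1 -> 'I_n.+1} | (\sum_i a i == n)%N)
     \prod_i y i ^+ a i) *+ n`!.
Proof.
pose ct (f : {ffun 'I_n -> 'I_N.+1}) : {ffun 'I_N.+1 -> 'I_n.+1} :=
  [ffun i => inord (content f i)].
have ctE f i : ct f i = content f i :> nat.
  rewrite ffunE inordK // ltnS /content -[leqRHS]card_ord -sum1_card.
  by apply: leq_sum => x _; case: eqP.
have sum_ct f : (\sum_i ct f i == n)%N.
  under eq_bigr do rewrite ctE.
  rewrite exchange_big /= -[X in _ == X]card_ord -sum1_card; apply/eqP/eq_bigr.
  move=> x _; rewrite (bigD1 (f x)) //= eqxx big1 // => i ne_i.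
  by rewrite eq_sym (negbTE ne_i).
under eq_bigr do rewrite (prod_porbits_psum ord0).
rewrite (exchange_big_dep predT) //=.
rewrite (partition_big ct (fun a => \sum_i a i == n)%N) //= -sumrMnl.
apply: eq_bigr => a /eqP sum_a.
have [g ga] := content_surj sum_a.
have ct_prod (f : {ffun 'I_n -> 'I_N.+1}) : \prod_x y (f x) = \prod_i y i ^+ ct f i.
  rewrite (partition_big f predT) //=; apply: eq_bigr => i _.
  rewrite (eq_bigr (fun=> y i)) => [|x /eqP->//]; rewrite prodr_const ctE.
  congr (_ ^+ _); rewrite /content -sum1_card big_mkcond.
  by apply: eq_bigr => x _; rewrite unfold_in.
rewrite -(sum_stab_content g) -sumrMnr.
apply: eq_big => [f|f /eqP <-].
  apply/eqP/forallP => [fa i|fg].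
    by rewrite -ctE fa ga.
  by apply/ffunP => i; apply/val_inj; rewrite /= ctE (eqP (fg i)) ga.
by rewrite -sumrMnr; apply: eq_bigr => s _; rewrite ct_prod.
Qed.

Lemma coef_prod_poly (R : comNzRingType) (I : finType) (K l : nat)
    (F : I -> nat -> R) :
  (\prod_(i : I) \poly_(k < K) F i k)`_l
    = \sum_(a : {ffun I -> 'I_K} | (\sum_i a i == l)%N) \prod_i F i (a i).
Proof.
under eq_bigr do rewrite poly_def.
rewrite bigA_distr_bigA coef_sum [RHS]big_mkcond /=; apply: eq_bigr => a _.
rewrite (eq_bigr (fun i => (F i (a i))%:P * 'X^(a i))) => [|i _]; last first.
  by rewrite mul_polyC.
rewrite big_split /= -rmorph_prod /= -expr_sum coefCM coefXn eq_sym.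
by case: eqP; rewrite ?mulr1 ?mulr0.
Qed.

(** * Power series modulo t^k and the cycle index *)

(** Congruence modulo t^k; power series are represented by truncating polynomials. *)
Definition eq_trunc (R : nzRingType) (k : nat) (p q : {poly R}) :=
  forall i, (i < k)%N -> p`_i = q`_i.

Lemma eq_truncD (R : nzRingType) k (p q p' q' : {poly R}) :
  eq_trunc k p q -> eq_trunc k p' q' -> eq_trunc k (p + p') (q + q').
Proof. by move=> pq pq' i lt_ik; rewrite !coefD pq ?pq'. Qed.

Lemma eq_truncM (R : nzRingType) k (p q p' q' : {poly R}) :
  eq_trunc k p q -> eq_trunc k p' q' -> eq_trunc k (p * p') (q * q').
Proof.
move=> pq pq' i lt_ik; rewrite !coefM; apply: eq_bigr => j _.
rewrite pq ?pq' //; first by apply: leq_ltn_trans lt_ik; rewrite leq_subr.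
by apply: leq_ltn_trans lt_ik; rewrite -ltnS.
Qed.

Lemma eq_trunc_prod (R : comNzRingType) (I : Type) (r : seq I) k
    (F G : I -> {poly R}) :
  (forall i, eq_trunc k (F i) (G i)) ->
  eq_trunc k (\prod_(i <- r) F i) (\prod_(i <- r) G i).
Proof.
move=> FG; elim: r => [|i r IHr]; first by rewrite !big_nil.
by rewrite !big_cons; apply: eq_truncM.
Qed.

(** Logarithmic derivatives add under products; [L i] stands for F_i'/F_i, written without
    division. *)
Lemma eq_trunc_dlog_prod (R : comNzRingType) (I : Type) (r : seq I) k
    (F L : I -> {poly R}) :
  (forall i, eq_trunc k (F i)^`() (L i * F i)) ->
  eq_trunc k (\prod_(i <- r) F i)^`()
             ((\sum_(i <- r) L i) * \prod_(i <- r) F i).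
Proof.
move=> FL; elim: r => [|i r IHr].
  by rewrite !big_nil derivC mul0r.
rewrite !big_cons derivM.
have -> : (L i + \sum_(j <- r) L j) * (F i * \prod_(j <- r) F j) =
  L i * F i * \prod_(j <- r) F j + F i * ((\sum_(j <- r) L j) * \prod_(j <- r) F j)
  by ring.
by apply: eq_truncD; apply: eq_truncM.
Qed.

Lemma eq_trunc_coefS (R : nzRingType) k (p c : {poly R}) (m : nat) :
  eq_trunc k p^`() (c * p) -> (m < k)%N ->
  p`_m.+1 *+ m.+1 = \sum_(j < m.+1) c`_j * p`_(m - j).
Proof. by move=> pc /pc; rewrite coef_deriv coefM. Qed.

(** The equation p' = c p is a recursion for (m+1) p_(m+1), and m+1 is invertible. Integration gains
    one order of precision. *)
Lemma eq_trunc_dlog_uniq (A : lalgType rat) k (p q c : {poly A}) :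
  p`_0 = q`_0 -> eq_trunc k p^`() (c * p) -> eq_trunc k q^`() (c * q) ->
  eq_trunc k.+1 p q.
Proof.
move=> pq0 pc qc m; elim/ltn_ind: m => -[//|m] IHm lt_mk.
have : p`_m.+1 *+ m.+1 = q`_m.+1 *+ m.+1.
  rewrite (eq_trunc_coefS pc) // (eq_trunc_coefS qc) //.
  by apply: eq_bigr => j _; rewrite IHm // ?(ltnS, leq_subr) //; lia.
rewrite -!scaler_nat => /(congr1 (GRing.scale (m.+1%:R : rat)^-1)).
by rewrite !scalerA mulVf ?pnatr_eq0 // !scale1r.
Qed.

Lemma rec_uniq (A : lalgType rat) k (c g h : nat -> A) :
  g 0 = h 0 ->
  (forall m, (m < k)%N -> g m.+1 *+ m.+1 = \sum_(j < m.+1) c j.+1 * g (m - j)%N) ->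
  (forall m, (m < k)%N -> h m.+1 *+ m.+1 = \sum_(j < m.+1) c j.+1 * h (m - j)%N) ->
  forall m, (m <= k)%N -> g m = h m.
Proof.
move=> gh0 gc hc m; elim/ltn_ind: m => -[//|m] IHm lt_mk.
have : g m.+1 *+ m.+1 = h m.+1 *+ m.+1.
  rewrite gc // hc //.
  by apply: eq_bigr => j _; rewrite IHm // ?(ltnS, leq_subr) //; lia.
rewrite -!scaler_nat => /(congr1 (GRing.scale (m.+1%:R : rat)^-1)).
by rewrite !scalerA mulVf ?pnatr_eq0 // !scale1r.
Qed.

(** Truncated form of the fact that 1/(1 - x t) has logarithmic derivative x/(1 - x t). *)
Lemma geom_dlog (R : comNzRingType) (x : R) (M : nat) :
  eq_trunc M (\poly_(k < M.+1) x ^+ k)^`()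
    ((\poly_(k < M) x ^+ k.+1) * \poly_(k < M.+1) x ^+ k).
Proof.
move=> i lt_iM; rewrite coef_deriv coef_poly ltnS lt_iM coefM.
rewrite (eq_bigr (fun=> x ^+ i.+1)) => [|j _]; first by rewrite sumr_const card_ord.
rewrite !coef_poly.
have -> : (j < M)%N by have := ltn_ord j; lia.
have -> : (i - j < M.+1)%N by lia.
by rewrite -exprD; congr (x ^+ _); have := ltn_ord j; lia.
Qed.

(** This is h_m with [c k] substituted for p_k, the t^m coefficient of exp(sum_k c_k t^k / k). *)
Definition cycle_index (A : comAlgType rat) (c : nat -> A) (m : nat) : A :=
  (m`!%:R : rat)^-1 *: \sum_(s : 'S_m) \prod_(C in porbits s) c #|C|.

Lemma card_porbits_in (T : finType) (s : {perm T}) (C : {set T}) :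
  C \in porbits s -> (0 < #|C| <= #|T|)%N.
Proof.
by case/imsetP => x _ ->; rewrite lt0n card_porbit_neq0 max_card.
Qed.

Lemma eq_cycle_index (A : comAlgType rat) (c d : nat -> A) (m : nat) :
  (forall k, (0 < k <= m)%N -> c k = d k) -> cycle_index c m = cycle_index d m.
Proof.
move=> cd; congr (_ *: _); apply: eq_bigr => s _; apply: eq_bigr => C.
by move/card_porbits_in; rewrite card_ord => /cd.
Qed.

Lemma cycle_index_morph (A B : comAlgType rat) (f : {lrmorphism A -> B})
    (c : nat -> A) (m : nat) :
  f (cycle_index c m) = cycle_index (f \o c) m.
Proof.
rewrite /cycle_index linearZ /= rmorph_sum; congr (_ *: _).
by apply: eq_bigr => s _; rewrite rmorph_prod.
Qed.

(** The generating function of the h_m is prod_i 1/(1 - y_i t). The order [M] is free so that one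
    polynomial serves all smaller [m]. *)
Lemma cycle_index_psum (A : comAlgType rat) (N : nat) (y : 'I_N.+1 -> A)
    (m M : nat) : (m <= M)%N ->
  cycle_index (fun k => \sum_i y i ^+ k) m
    = (\prod_i \poly_(k < M.+1) y i ^+ k)`_m.
Proof.
move=> le_mM; transitivity ((\prod_i \poly_(k < m.+1) y i ^+ k)`_m).
  rewrite (coef_prod_poly m.+1 m (fun i k => y i ^+ k)) /cycle_index.
  by rewrite sum_perm_psum -scaler_nat scalerA mulVf ?scale1r // pnatr_eq0 -lt0n fact_gt0.
apply: (@eq_trunc_prod _ _ _ m.+1) => // i j lt_jm.
by rewrite !coef_poly lt_jm (leq_trans lt_jm).
Qed.

(** Newton's identity, read off the logarithmic derivative of prod_i 1/(1 - y_i t). *)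
Lemma cycle_index_psum_rec (A : comAlgType rat) (N : nat) (y : 'I_N.+1 -> A)
    (m : nat) (p := fun k => \sum_i y i ^+ k) :
  cycle_index p m.+1 *+ m.+1 = \sum_(j < m.+1) p j.+1 * cycle_index p (m - j).
Proof.
rewrite (@cycle_index_psum _ _ y m.+1 m.+1) //.
have := eq_trunc_dlog_prod (index_enum 'I_N.+1) (fun i => @geom_dlog _ (y i) m.+1).
move/eq_trunc_coefS => ->//; apply: eq_bigr => j _.
rewrite (@cycle_index_psum _ _ y (m - j) m.+1); last by lia.
congr (_ * _); rewrite coef_sum; apply: eq_bigr => i _.
by rewrite coef_poly ltn_ord.
Qed.

Lemma psumX (n : nat) (j : 'I_n) : psum n j.+1 = 'X_j.
Proof. by rewrite /psum (big_pred1 j) // => i. Qed.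

Lemma psum_ev_vars (n N k : nat) : (0 < k <= n)%N ->
  psum n k \mPo ev_vars n N = \sum_(j < N) 'X_j ^+ k.
Proof.
case: k => // k lt_kn; rewrite (psumX (Ordinal lt_kn)) comp_mpolyXU -tnth_nth.
by rewrite tnth_mktuple.
Qed.

(* The recursion is a polynomial identity in the c_k, so it suffices to check
   it when the c_k are power sums, by algebraic independence. *)
Lemma cycle_index_rec (n : nat) (c : nat -> {mpoly rat[n]}) (m : nat) :
  cycle_index c m.+1 *+ m.+1 = \sum_(j < m.+1) c j.+1 * cycle_index c (m - j).
Proof.
(* Cycles have length at most m+1 here, so m+1 generators suffice. *)
pose p := psum m.+1.
have univ : cycle_index p m.+1 *+ m.+1
    = \sum_(j < m.+1) p j.+1 * cycle_index p (m - j).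
  apply/eqP; rewrite -subr_eq0; apply/eqP/psum_alg_indep.
  have pE k : (k <= m.+1)%N -> cycle_index p k \mPo ev_vars m.+1 m.+1
      = cycle_index (fun k => \sum_(j < m.+1) 'X_j ^+ k) k :> {mpoly rat[m.+1]}.
    move=> le_km; rewrite -[LHS]/(comp_mpoly _ _) cycle_index_morph.
    apply: eq_cycle_index => j /andP[j0 le_jk] /=.
    by rewrite psum_ev_vars // j0 (leq_trans le_jk).
  rewrite rmorphB rmorphMn rmorph_sum /= pE // cycle_index_psum_rec.
  apply/eqP; rewrite subr_eq0; apply/eqP/eq_bigr => j _.
  by rewrite rmorphM /= psum_ev_vars ?ltn_ord // pE //; lia.
pose lc := [tuple c i.+1 | i < m.+1].
have pc k : (0 < k <= m.+1)%N -> p k \mPo lc = c k.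
  case: k => // k lt_km; rewrite /p (psumX (Ordinal lt_km)) comp_mpolyXU.
  by rewrite -tnth_nth tnth_mktuple.
have pcE k : (k <= m.+1)%N -> cycle_index p k \mPo lc = cycle_index c k.
  move=> le_km; rewrite -[LHS]/(comp_mpoly _ _) cycle_index_morph.
  apply: eq_cycle_index => j /andP[j0 le_jk] /=.
  by rewrite pc // j0 (leq_trans le_jk).
have := congr1 (comp_mpoly lc) univ.
rewrite rmorphMn rmorph_sum /= pcE // => ->; apply: eq_bigr => j _.
by rewrite rmorphM /= pc ?ltn_ord // pcE //; lia.
Qed.

Lemma cycle_index0 (A : comAlgType rat) (c : nat -> A) : cycle_index c 0 = 1.
Proof.
rewrite /cycle_index invr1 scale1r (big_pred1 1%g) => [|s].
  rewrite big1 // => C /card_porbits_in.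
  by rewrite card_ord => /andP[/leq_trans h /h].
by apply/esym/eqP/permP => -[].
Qed.

(** * One-row Schur P-functions *)

Definition odd_psum (n k : nat) : {mpoly rat[n]} :=
  if odd k then psum n k *+ 2 else 0.

(** Coefficients of (1 + x t)/(1 - x t) = 1 + 2 sum_(k > 0) x^k t^k. *)
Definition superX (R : nzRingType) (x : R) (k : nat) : R :=
  x ^+ k *+ (if k is 0 then 1 else 2)%N.

(** The logarithmic derivative of (1 + x t)/(1 - x t) is 2 x/(1 - x^2 t^2), which involves odd
    powers of x only. *)
Lemma superX_dlog (R : comNzRingType) (x : R) (M : nat) :
  eq_trunc M (\poly_(k < M.+1) superX x k)^`()
    ((\poly_(k < M) if odd k.+1 then x ^+ k.+1 *+ 2 else 0)
       * \poly_(k < M.+1) superX x k).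
Proof.
move=> i lt_iM; rewrite coef_deriv coef_poly ltnS lt_iM coefM.
have sum_odd l : (\sum_(j < l) 4 * ~~ odd j = 2 * (l + odd l))%N.
  by elim: l => [|l IHl]; rewrite ?big_ord0 // big_ord_recr /= IHl;
    case: (odd l) => /=; lia.
(* In the convolution each even [j] below [i] contributes 2 * 2, while [j = i] contributes 2 * 1 if
   even because the series has constant term 1. *)
have -> : superX x i.+1 *+ i.+1
    = x ^+ i.+1 *+ (\sum_(j < i) 4 * ~~ odd j + 2 * ~~ odd i)%N.
  rewrite /superX -mulrnA sum_odd; congr (_ *+ _).
  by case: (odd i) => /=; lia.
rewrite big_ord_recr /= subnn !coef_poly lt_iM /= /superX mulr1 mulrnDr.
congr (_ + _); last by case: (odd i) => /=; rewrite ?muln0 ?mulr0n ?mul0r ?muln1 ?mulr1.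
rewrite -sumrMnr; apply: eq_bigr => j _; have lt_ji := ltn_ord j.
rewrite !coef_poly.
have -> : (j < M)%N by lia.
have -> : (i - j < M.+1)%N by lia.
case: (odd j) => /=; first by rewrite mulr0n mul0r.
have -> : (if (i - j)%N is 0 then 1 else 2)%N = 2%N.
  by case: (i - j)%N (subn_gt0 j i) => [|//]; rewrite lt_ji.
rewrite mulrnAl mulrnAr -mulrnA -exprD; congr (x ^+ _ *+ _).
by lia.
Qed.

Lemma gen_coefE (N m M : nat) : (m <= M)%N ->
  gen_coef N m = (\prod_(i < N) \poly_(k < M.+1) superX ('X_i : {mpoly rat[N]}) k)`_m.
Proof.
move=> le_mM; apply: (@eq_trunc_prod _ _ _ m.+1) => // i j lt_jm.
have -> : \sum_(k < m.+1) (('X_i : {mpoly rat[N]})%:P * 'X) ^+ k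
    = \poly_(k < m.+1) 'X_i ^+ k.
  rewrite poly_def; apply: eq_bigr => k _.
  by rewrite exprMn -rmorphXn /= mul_polyC.
rewrite mulrDl mul1r coefD -mulrA coefCM coefXM !coef_poly lt_jm (leq_trans lt_jm) //.
case: j lt_jm => [|j] lt_jm /=; first by rewrite mulr0 addr0.
by rewrite ltnW // -exprS -mulr2n.
Qed.

Lemma gen_coef0 (N : nat) : gen_coef N 0 = 1.
Proof.
rewrite (@gen_coefE N 0 0) // coef0_prod big1 // => i _.
by rewrite coef_poly.
Qed.

Lemma gen_coef_rec (N m : nat) :
  gen_coef N m.+1 *+ m.+1 = \sum_(j < m.+1)
    (if odd j.+1 then (\sum_i 'X_i ^+ j.+1) *+ 2 else 0) * gen_coef N (m - j).
Proof.
rewrite (@gen_coefE N m.+1 m.+1) //.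
have := eq_trunc_dlog_prod (index_enum 'I_N)
  (fun i => @superX_dlog _ ('X_i : {mpoly rat[N]}) m.+1).
move/eq_trunc_coefS => ->//; apply: eq_bigr => j _.
rewrite (@gen_coefE N (m - j) m.+1); last by lia.
congr (_ * _); rewrite coef_sum; case: ifP => oj.
  by rewrite -sumrMnl; apply: eq_bigr => i _; rewrite coef_poly ltn_ord oj.
by rewrite big1 // => i _; rewrite coef_poly ltn_ord oj.
Qed.

(** Evaluated in n variables, both sides obey the recursion coming from the same logarithmic
    derivative; algebraic independence lifts the equality back. *)
Lemma schurP_cycle_index (n : nat) (P : nat -> {mpoly rat[n]}) (m : nat) :
  is_schurP_family P -> (1 <= m <= n)%N ->
  P m *+ 2 = cycle_index (odd_psum n) m.
Proof.
move=> HP m1n; apply/eqP; rewrite -subr_eq0; apply/eqP/psum_alg_indep.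
rewrite rmorphB /= rmorphMn /= -scaler_nat HP //; apply/eqP; rewrite subr_eq0.
pose c k : {mpoly rat[n]} := if odd k then (\sum_(i < n) 'X_i ^+ k) *+ 2 else 0.
have -> : cycle_index (odd_psum n) m \mPo ev_vars n n = cycle_index c m.
  rewrite -[LHS]/(comp_mpoly _ _) cycle_index_morph.
  apply: eq_cycle_index => j /andP[j0 le_jm] /=.
  rewrite /odd_psum /c; case: ifP => _; last exact: rmorph0.
  rewrite rmorphMn /= psum_ev_vars // j0; lia.
apply/eqP; apply: (@rec_uniq _ m c (gen_coef n)) => // [|l _|l _].
- by rewrite gen_coef0 cycle_index0.
- exact: gen_coef_rec.
- exact: cycle_index_rec.
Qed.

(** * Parking functions *)

(** In a sorted list the entries at most [v] form an initial segment. *)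
Lemma nth_sorted_leq (s : seq nat) (i v : nat) :
  sorted leq s -> (i < size s)%N ->
  (nth 0 s i <= v)%N = (i < count (leq^~ v) s)%N.
Proof.
elim: s i => // x s IHs i /= x_s lt_is.
have cnt0 : ~~ (x <= v)%N -> count (leq^~ v) s = 0%N.
  move=> lt_vx; apply/eqP; rewrite -leqn0 leqNgt -has_count -all_predC.
  apply: sub_all (order_path_min leq_trans x_s) => z /= le_xz.
  by apply: contra lt_vx; apply: leq_trans.
case: i lt_is => [|i] lt_is /=.
  by case: (leqP x v) => //; rewrite ltnNge => /cnt0->.
rewrite IHs ?(path_sorted x_s) //.
by case: (leqP x v) => //; rewrite ltnNge => /cnt0->.
Qed.

Definition below (n m : nat) (g : {ffun 'I_n -> 'I_m}) (k : nat) : nat :=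
  (\sum_(i < n) (g i < k))%N.

Lemma is_parking_below (n : nat) (f : {ffun 'I_n -> 'I_n}) :
  is_parking f = [forall k : 'I_n.+1, (k <= below f k)%N].
Proof.
rewrite /is_parking; set s := sort _ _.
have size_s : size s = n by rewrite size_sort size_map size_enum_ord.
have sorted_s : sorted leq s by apply: sort_sorted; apply: leq_total.
have count_s v : count (leq^~ v) s = below f v.+1.
  rewrite (seq.permP (permEl (perm_sort _ _))) count_map -sum1_count big_mkcond big_enum /=.
  by apply: eq_bigr => i _ /=; rewrite ltnS; case: (f i <= v)%N.
apply/forallP/forallP => [pk [[|k] /= lt_k]|pk i] //.
  have := pk (Ordinal (lt_k : (k < n)%N)); rewrite nth_sorted_leq ?size_s //.
  by rewrite count_s.
rewrite nth_sorted_leq ?size_s // count_s.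
by have /= := pk (lift ord0 i).
Qed.

Lemma val_ordB (n : nat) (a b : 'I_n.+1) :
  (a - b)%R = (if (b <= a)%N then a - b else a + n.+1 - b)%N :> nat.
Proof.
have [la lb] := (ltn_ord a, ltn_ord b).
rewrite /= modnDmr; case: leqP => ba.
  by rewrite addnBA ?(ltnW lb) // addnC -addnBA // modnDl modn_small //; lia.
by rewrite addnBA ?(ltnW lb) // modn_small //; lia.
Qed.

Section Pollak.
Variables (n : nat).
Implicit Types (g : {ffun 'I_n -> 'I_n.+1}) (r : 'I_n.+1).

(** The counting criterion for parking, now for preferences on a circle of n+1 spots. *)
Definition park g := [forall k : 'I_n.+1, (k <= below g k)%N].
Definition rotate g r : {ffun 'I_n -> 'I_n.+1} := [ffun i => g i - r].
(** Encodes the pair (below g j - j, j) for lexicographic comparison; adding [n] keeps the first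
    entry a natural number. *)
Definition dip_rank g (j : nat) := ((below g j + (n - j)) * n.+1 + j)%N.

(** The arc of length [k] starting at [r] does not wrap around. *)
Lemma below_rotate_lo g r k : (r + k <= n.+1)%N ->
  (below (rotate g r) k + below g r = below g (r + k))%N.
Proof.
move=> le_rk; rewrite -big_split; apply: eq_bigr => i _ /=; rewrite ffunE val_ordB.
by have := ltn_ord (g i); have := ltn_ord r; case: ifP => ?; lia.
Qed.

(** Here the arc wraps around, so all [n] values are counted once more. *)
Lemma below_rotate_hi g r k : (k <= n)%N -> (n < r + k)%N ->
  (below (rotate g r) k + below g r = n + below g (r + k - n.+1))%N.
Proof.
move=> le_kn lt_rk.
have -> c : (n + c = \sum_(i < n) 1 + c)%N by rewrite sum1_card card_ord.
rewrite -!big_split; apply: eq_bigr => i _ /=; rewrite ffunE val_ordB.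
by have := ltn_ord (g i); have := ltn_ord r; case: ifP => ?; lia.
Qed.

(* Exactly one rotation is a parking function: the one starting at the first
   minimum of j |-> below g j - j; [dip_rank] breaks ties lexicographically. *)
Lemma park_rotate g r :
  park (rotate g r) = [forall j : 'I_n.+1, (dip_rank g r <= dip_rank g j)%N].
Proof.
have lt_r := ltn_ord r; apply/forallP/forallP => [pk j|le_rank k].
  have lt_j := ltn_ord j; rewrite /dip_rank; case: (leqP r j) => le_rj.
    have lt_k : (j - r < n.+1)%N by lia.
    have := pk (Ordinal lt_k) => /= pk_k.
    have := @below_rotate_lo g r (j - r); rewrite subnKC // => /(_ (ltnW lt_j)) e.
    by apply: leq_add => //; apply: leq_mul => //; lia.
  (* An index before [r] is reached by wrapping; the circle having n+1 spots for n values makes the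
     inequality strict, as the tie-break demands. *)
  have lt_k : (j + n.+1 - r < n.+1)%N by lia.
  have := pk (Ordinal lt_k) => /= pk_k.
  have := @below_rotate_hi g r (j + n.+1 - r).
  have -> : (r + (j + n.+1 - r) - n.+1 = j)%N by lia.
  move=> /(_ ltac:(lia) ltac:(lia)) e.
  have : (below g r + (n - r) < below g j + (n - j))%N by lia.
  by nia.
have lt_k := ltn_ord k; case: (leqP (r + k) n) => le_rk.
  have /= := le_rank (Ordinal (le_rk : (r + k < n.+1)%N)); rewrite /dip_rank => le_r.
  have e := @below_rotate_lo g r k (leqW le_rk).
  have : (below g r + (n - r) <= below g (r + k) + (n - (r + k)))%N by nia.
  by lia.
have lt_j : (r + k - n.+1 < n.+1)%N by lia.
have /= := le_rank (Ordinal lt_j); rewrite /dip_rank => le_r.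
have e := @below_rotate_hi g r k ltac:(lia) le_rk.
have : (below g r + (n - r) < below g (r + k - n.+1) + (n - (r + k - n.+1)))%N by nia.
by lia.
Qed.

Lemma sum_park_rotate g : (\sum_r park (rotate g r) = 1)%N.
Proof.
have [r _ min_r] := @arg_minnP _ (@ord0 n) xpredT (fun r => dip_rank g r) isT.
rewrite (bigD1 r) //= park_rotate big1 ?addn0 => [|r' ne_r'].
  by apply/eqP; rewrite eqb1; apply/forallP => j; apply: min_r.
apply/eqP; rewrite eqb0 park_rotate; apply: contra ne_r' => /forallP min_r'.
have e : dip_rank g r = dip_rank g r' by apply/eqP; rewrite eqn_leq min_r' min_r.
(* The rank modulo n+1 recovers the index, so the minimiser is unique. *)
move/(congr1 (modn^~ n.+1)): e; rewrite /dip_rank !modnMDl !modn_small //.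
by move=> e; apply/eqP/val_inj.
Qed.

(** The criterion at k = n forces all values below n, so enlarging the codomain adds no parking
    function. *)
Lemma pf_char_park (s : 'S_n) :
  pf_char s = (\sum_(g : {ffun 'I_n -> 'I_n.+1} | [forall x, g (s x) == g x]) park g)%N.
Proof.
pose w (f : {ffun 'I_n -> 'I_n}) : {ffun 'I_n -> 'I_n.+1} :=
  [ffun i => widen_ord (leqnSn n) (f i)].
have w_inj : injective w.
  move=> f f' /ffunP ff; apply/ffunP => i; have := ff i; rewrite !ffunE.
  by move/(congr1 val) => /= /val_inj.
have below_w f k : below (w f) k = below f k.
  by apply: eq_bigr => i _; rewrite ffunE.
rewrite /pf_char -(card_imset _ w_inj) -sum1_card big_mkcond [RHS]big_mkcond /=.
apply: eq_bigr => g _.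
transitivity (nat_of_bool ([forall x, g (s x) == g x] && park g)); last first.
  by case: [forall x, _] => //=; case: park.
congr nat_of_bool; apply/imsetP/andP => [[f]|[/forallP gs pk]].
  rewrite inE => /andP[]; rewrite is_parking_below => /forallP pk /forallP fs ->.
  split; apply/forallP; last by move=> k; rewrite below_w.
  by move=> x; rewrite !ffunE (eqP (fs x)).
have lt_g i : (g i < n)%N.
  have := forallP pk ord_max; rewrite /= => le_n; rewrite ltnNge; apply/negP => le_ng.
  move: le_n; rewrite /below (bigD1 i) //= ltnNge le_ng /= add0n.
  apply/negP; rewrite -ltnNge.
  apply: (@leq_ltn_trans (\sum_(j < n | j != i) 1)%N).
    by apply: leq_sum => j _; case: (_ < _)%N.
  rewrite sum1_card cardC1 card_ord prednK //.
  by apply: leq_ltn_trans (ltn_ord i).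
have gw : g = w [ffun i => Ordinal (lt_g i)].
  by apply/ffunP => i; apply/val_inj; rewrite !ffunE.
exists [ffun i => Ordinal (lt_g i)] => //.
rewrite inE is_parking_below; apply/andP; split.
  by apply/forallP => k; rewrite -below_w -gw (forallP pk).
by apply/forallP => x; rewrite !ffunE -val_eqE /= (eqP (gs x)).
Qed.

(** There are (n+1)^(number of cycles) functions into Z/(n+1) fixed by [s], each with exactly one
    parking rotation. Rotations preserve being fixed by [s], so each of the n+1 rotations accounts
    for chi(s) of them. *)
Lemma pf_char_porbits (s : 'S_n) :
  (pf_char s)%:R * n.+1%:R = n.+1%:R ^+ #|porbits s| :> rat.
Proof.
have := prod_porbits_psum (@ord0 n) s (fun=> 1 : rat).
rewrite (eq_bigr (fun=> n.+1%:R)) => [|C _]; last first.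
  by under eq_bigr do rewrite expr1n; rewrite sumr_const card_ord.
rewrite prodr_const => ->.
rewrite (eq_bigr (fun=> 1%:R)) => [|g _]; last by rewrite big1.
rewrite -natrM -natr_sum; congr (_%:R).
transitivity (\sum_(g : {ffun 'I_n -> 'I_n.+1} | [forall x, g (s x) == g x])
    \sum_r park (rotate g r))%N; last by apply: eq_bigr => g _; rewrite sum_park_rotate.
rewrite exchange_big /= pf_char_park mulnC -[X in (X * _)%N]card_ord -sum_nat_const.
apply: eq_bigr => r _.
have rotate_inj : injective (fun g => rotate g r).
  move=> g g' /ffunP gg; apply/ffunP => i; have := gg i; rewrite !ffunE.
  exact: addIr.
rewrite (reindex_inj rotate_inj) /=; apply: eq_bigl => g.
by apply/forallP/forallP => gs x; have := gs x; rewrite !ffunE (inj_eq (addIr _)).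
Qed.

End Pollak.

(** * Powers of the exponential of an odd series *)

(** With an explicit remainder, congruences can be combined by [ring]. *)
Lemma eq_truncP (R : nzRingType) k (p q : {poly R}) :
  eq_trunc k p q <-> exists r, p = q + r * 'X^k.
Proof.
split=> [pq|[r ->] i lt_ik]; last by rewrite coefD coefMXn lt_ik addr0.
exists (drop_poly k (p - q)); rewrite -[LHS](subrK q) addrC; congr (_ + _).
rewrite -{1}[p - q](poly_take_drop k); have -> : take_poly k (p - q) = 0.
  apply/polyP => i; rewrite coef_take_poly coef0 coefB.
  by case: ltnP => // /pq ->; rewrite subrr.
by rewrite add0r.
Qed.

Lemma coef_expX_small (R : nzRingType) (p : {poly R}) (i j : nat) :
  p`_0 = 0 -> (j < i)%N -> (p ^+ i)`_j = 0.
Proof.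
move=> p0; elim: i j => // i IHi j lt_ji; rewrite exprS coefM.
rewrite big_ord_recl p0 mul0r add0r big1 // => l _.
rewrite IHi ?mulr0 //=; rewrite /bump /=; have := ltn_ord l; lia.
Qed.

Lemma eq_trunc_comp (R : comNzRingType) k (p q u : {poly R}) :
  u`_0 = 0 -> eq_trunc k p q -> eq_trunc k (p \Po u) (q \Po u).
Proof.
move=> u0 pq i lt_ik; apply/eqP; rewrite -subr_eq0 -coefB -comp_polyB.
rewrite comp_polyE coef_sum big1 // => j _; rewrite coefZ.
case: (ltnP j k) => [lt_jk|le_kj]; first by rewrite coefB pq ?subrr ?mul0r.
by rewrite coef_expX_small ?mulr0 // (leq_trans lt_ik).
Qed.

(* Taylor coefficients in u of (u + sqrt (1 + u^2)) ^ a = exp (a arcsinh u). *)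
Definition asinh_coef (a : rat) (l : nat) : rat :=
  if l is l'.+1 then a * \prod_(j < l') (a + l'%:R - 1 - 2%:R * j%:R) / l`!%:R
  else 1.

(** Coefficient form of (1 + u^2) y'' + u y' = a^2 y. For l > 0, passing from l to l+2 adds the
    outer factors a + l and a - l to the product. *)
Lemma asinh_coef_rec (a : rat) (l : nat) :
  asinh_coef a l.+2 * (l.+2 * l.+1)%:R = (a ^+ 2 - l%:R ^+ 2) * asinh_coef a l.
Proof.
have fact0 m : (m`!%:R : rat) != 0 by rewrite pnatr_eq0 -lt0n fact_gt0.
case: l => [|l].
  rewrite /asinh_coef big_ord_recl big_ord0 /= (_ : 2`! = 2)%N //.
  by rewrite (_ : (2 * 1 = 2)%N) //; field.
pose Pi : rat := \prod_(j < l) (a + l%:R - 1 - 2%:R * j%:R).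
have -> : asinh_coef a l.+3 = a * ((a + l%:R + 1) * (Pi * (a - l%:R - 1)))
    / (l.+3%:R * (l.+2%:R * l.+1`!%:R)).
  rewrite /asinh_coef big_ord_recl big_ord_recr.
  have -> : l.+3%:R * (l.+2%:R * l.+1`!%:R) = l.+3`!%:R :> rat.
    by rewrite -!natrM -!factS.
  congr (_ * (_ * (_ * _)) / _).
  - by rewrite -!natr1 /=; ring.
  - apply: eq_bigr => j _; rewrite lift0 -!natr1 /=; ring.
  - by rewrite lift0 -!natr1 /=; ring.
rewrite /asinh_coef -/Pi natrM -!natr1 -/asinh_coef.
move: (fact0 l.+1); move: (l.+1`!%:R : rat) => F F0.
have n3 : (l%:R + 1 + 1 + 1 : rat) != 0 by rewrite !natr1 pnatr_eq0.
have n2 : (l%:R + 1 + 1 : rat) != 0 by rewrite !natr1 pnatr_eq0.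
by field; rewrite ?F0 ?n3 ?n2.
Qed.

Section OddExponential.
(** With C = sum_k c_k t^k / k, the sequences [q] and [w] are the coefficients of exp(C) and exp(a
    C) up to t^n, given by their recursions. *)
Variables (A : comAlgType rat) (n : nat) (c q w : nat -> A) (a : rat).
Hypothesis c_even : forall k, ~~ odd k -> c k = 0.
Hypothesis q0 : q 0 = 1.
Hypothesis q_rec : forall m, (m < n)%N ->
  q m.+1 *+ m.+1 = \sum_(j < m.+1) c j.+1 * q (m - j)%N.
Hypothesis w0 : w 0 = 1.
Hypothesis w_rec : forall m, (m < n)%N ->
  w m.+1 *+ m.+1 = \sum_(j < m.+1) (a *: c j.+1) * w (m - j)%N.

Let K := \poly_(i < n) c i.+1.
Let O := \poly_(i < n.+1) (if odd i then q i else 0).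
Let E := \poly_(i < n.+1) (if odd i then 0 else q i).
Let al : {poly A} := (a%:A)%:P.

Let O0 : O`_0 = 0.
Proof. by rewrite coef_poly. Qed.

Let E0 : E`_0 = 1.
Proof. by rewrite coef_poly. Qed.

(** The series [K] = C' is even, so multiplying by it keeps parity while differentiation flips it:
    Q' = K Q splits into two equations for [O] and [E]. *)
Let dO : eq_trunc n O^`() (K * E).
Proof.
move=> i lt_in; rewrite coef_deriv coefM coef_poly ltnS lt_in /=.
have coefE (j : 'I_i.+1) : K`_j * E`_(i - j)
    = if ~~ odd i then c j.+1 * q (i - j)%N else 0.
  have lt_ji := ltn_ord j; rewrite !coef_poly.
  have -> : (j < n)%N by lia.
  have -> : (i - j < n.+1)%N by lia.
  rewrite oddB //; case oj: (odd j); last first.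
    by rewrite addbF; case: (odd i); rewrite ?mulr0.
  by rewrite (@c_even j.+1) /= ?oj // !mul0r; case: ifP.
under eq_bigr do rewrite coefE.
by case: ifP => _; [rewrite q_rec | rewrite mul0rn big1_eq].
Qed.

Let dE : eq_trunc n E^`() (K * O).
Proof.
move=> i lt_in; rewrite coef_deriv coefM coef_poly ltnS lt_in /=.
have coefE (j : 'I_i.+1) : K`_j * O`_(i - j)
    = if ~~ odd i then 0 else c j.+1 * q (i - j)%N.
  have lt_ji := ltn_ord j; rewrite !coef_poly.
  have -> : (j < n)%N by lia.
  have -> : (i - j < n.+1)%N by lia.
  rewrite oddB //; case oj: (odd j); last first.
    by rewrite addbF; case: (odd i); rewrite ?mulr0.
  by rewrite (@c_even j.+1) /= ?oj // !mul0r; case: ifP.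
under eq_bigr do rewrite coefE.
by case: ifP => _; [rewrite mul0rn big1_eq | rewrite q_rec].
Qed.

(** The derivative of E^2 - O^2 is 2 (E K O - O K E) = 0, and its constant term is 1. *)
Let EO : eq_trunc n.+1 (E ^+ 2) (1 + O ^+ 2).
Proof.
have h : eq_trunc n.+1 (E ^+ 2 - O ^+ 2) 1.
  apply: (@eq_trunc_dlog_uniq _ n _ _ 0).
  - by rewrite coefB !expr2 !coef0M O0 E0 mulr0 subr0 mulr1 coef1.
  - have [[r1 e1] [r2 e2]] := (proj1 (eq_truncP _ _ _) dO, proj1 (eq_truncP _ _ _) dE).
    apply/eq_truncP; exists ((r2 * E - r1 * O) *+ 2).
    by rewrite derivB !expr2 !derivM e1 e2; ring.
  - by rewrite derivC mul0r.
by move=> i lt_in; have := h i lt_in; rewrite coefB coefD => <-; rewrite subrK.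
Qed.

(** Two terms beyond t^n are kept because the equation for [B] involves a second derivative. *)
Let B := \poly_(l < n.+3) (asinh_coef a l)%:A : {poly A}.

Let B_ode : eq_trunc n.+1 ((1 + 'X^2) * B^`()^`() + 'X * B^`()) (al ^+ 2 * B).
Proof.
move=> i lt_in; rewrite -polyC_exp coefCM coefD mulrDl mul1r coefD coefXnM coefXM.
rewrite !coef_deriv.
have coefB l : (l < n.+3)%N -> B`_l = (asinh_coef a l)%:A.
  by move=> lt_l; rewrite coef_poly lt_l.
rewrite !coefB; try lia.
have natA (x : rat) k : x%:A *+ k = (x * k%:R)%:A :> A.
  by rewrite mulr_natr scalerMnl.
have main : (asinh_coef a i.+2)%:A *+ i.+2 *+ i.+1 + (asinh_coef a i * i%:R ^+ 2)%:A
    = a%:A ^+ 2 * (asinh_coef a i)%:A :> A.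
  rewrite !natA -mulrA -natrM asinh_coef_rec -scalerDl.
  rewrite exprZn expr1n -scalerAl mul1r scalerA; congr (_ *: _).
  by ring.
rewrite -main -addrA; congr (_ + _).
move: (asinh_coef a) => b; case: i {lt_in main} => [|[|i]] /=;
  rewrite ?mulr0n ?expr0n ?mulr0 ?scale0r ?addr0 ?add0r //.
rewrite !subSS subn0 !natA -scalerDl; congr (_ *: _).
by rewrite -natr1 -(natr1 i); ring.
Qed.

Let BO := B \Po O.
Let dBO := B^`() \Po O.

(* [E * B'(O)] and [a * B(O)] solve the same linear system, so they agree. *)
Let dBO_E : eq_trunc n.+1 (E * dBO) (al * BO).
Proof.
have [r1 e1] := proj1 (eq_truncP _ _ _) dO.
have [r2 e2] := proj1 (eq_truncP _ _ _) dE.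
have [r3 e3] := proj1 (eq_truncP _ _ _) EO.
have [r4 e4] := proj1 (eq_truncP _ _ _) (eq_trunc_comp O0 B_ode).
have {}e4 : (1 + O ^+ 2) * (B^`()^`() \Po O) + O * dBO = al ^+ 2 * BO + r4 * 'X^(n.+1).
  move: e4; rewrite comp_polyD !comp_polyM comp_polyD comp_polyX comp_Xn_poly.
  by rewrite -[1]/(1%:P) !comp_polyC -expr2.
have h : eq_trunc n.+1 (E * dBO - al * BO) 0.
  (* For D = E B'(O) - a B(O), the equation of [B] and E^2 = 1 + O^2 give D' = - a K D, with D(0) =
     a - a = 0. *)
  apply: (@eq_trunc_dlog_uniq _ n _ _ (- (al * K))).
  - rewrite coefB coefCM coefM big_ord1 E0 mul1r coef0.
    rewrite -!horner_coef0 !horner_comp !horner_coef0 O0 !horner_coef0.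
    by rewrite coef_deriv !coef_poly /= /asinh_coef big_ord0 mulr1 divr1 scale1r mulr1 subrr.
  - apply/eq_truncP.
    exists (r2 * dBO + E * (B^`()^`() \Po O) * r1 - al * dBO * r1 
       + K * 'X * (r3 * (B^`()^`() \Po O)) + K * 'X * r4).
    rewrite derivB !derivM derivC mul0r add0r !deriv_comp -/dBO e1 e2 -/(dBO).
    have -> : E * ((B^`()^`() \Po O) * (K * E + r1 * 'X^n)) =
      K * ((E ^+ 2) * (B^`()^`() \Po O)) + E * (B^`()^`() \Po O) * r1 * 'X^n by ring.
    have -> : E ^+ 2 * (B^`()^`() \Po O) = al ^+ 2 * BO + r4 * 'X^(n.+1) - O * dBO
        + r3 * 'X^(n.+1) * (B^`()^`() \Po O).
      by rewrite -e4 e3; ring.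
    by rewrite (exprS 'X n); ring.
  - by rewrite raddf0 mulr0.
by move=> i lt_in; have := h i lt_in; rewrite coefB coef0 => /eqP; rewrite subr_eq0 => /eqP.
Qed.

Lemma odd_exponential :
  w n = \sum_(l < n.+1) asinh_coef a l *: (O ^+ l)`_n.
Proof.
pose W := \poly_(i < n.+1) w i.
have h : eq_trunc n.+1 W BO.
  (* Both series start with 1 and satisfy y' = a K y: indeed B(O)' = B'(O) K E = a K B(O). *)
  apply: (@eq_trunc_dlog_uniq _ n _ _ (al * K)).
  - rewrite -(horner_coef0 BO) horner_comp horner_coef0 O0 horner_coef0.
    by rewrite !coef_poly w0 /= scale1r.
  - move=> i lt_in; rewrite coef_deriv coefM coef_poly ltnS lt_in w_rec //.
    apply: eq_bigr => j _; have lt_ji := ltn_ord j.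
    rewrite coefCM !coef_poly.
    have -> : (j < n)%N by lia.
    have -> : (i - j < n.+1)%N by lia.
    by rewrite mulr_algl.
  - have [r1 e1] := proj1 (eq_truncP _ _ _) dO.
    have [r2 e2] := proj1 (eq_truncP _ _ _) dBO_E.
    apply/eq_truncP; exists (dBO * r1 + K * r2 * 'X).
    rewrite deriv_comp -/dBO e1.
    have -> : dBO * (K * E + r1 * 'X^n) = K * (E * dBO) + dBO * r1 * 'X^n by ring.
    by rewrite e2 (exprS 'X n); ring.
have := h n (ltnSn n); rewrite coef_poly ltnSn => ->.
have -> : BO = \sum_(l < n.+3) (asinh_coef a l)%:A *: O ^+ l.
  rewrite /BO /B poly_def raddf_sum; apply: eq_bigr => l _ /=.
  by rewrite comp_polyZ comp_Xn_poly.
rewrite coef_sum 2!big_ord_recr /= ![(_ *: O ^+ _.+1)`_n]coefZ.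
rewrite (@coef_expX_small _ O n.+1 n) // (@coef_expX_small _ O n.+2 n) //.
rewrite !mulr0 !addr0.
by apply: eq_bigr => l _; rewrite coefZ mulr_algl.
Qed.

End OddExponential.

(** * The expansion of SH *)

(** Truncated form of prod_i exp(y_i t) = exp(t sum_i y_i). The morphism [iota] supplies rational
    scalars in {poly A}, where scaling is by A. *)
Lemma coef_prod_exp (R : comNzRingType) (iota : {rmorphism rat -> R})
    (I : Type) (r : seq I) (y : I -> R) (M l : nat) : (l <= M)%N ->
  (\prod_(i <- r) \poly_(k < M.+1) (y i ^+ k * iota (k`!%:R)^-1))`_l
    = (\sum_(i <- r) y i) ^+ l * iota (l`!%:R)^-1.
Proof.
have fact0 m : (m`!%:R : rat) != 0 by rewrite pnatr_eq0 -lt0n fact_gt0.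
elim: r l => [|i r IHr] l le_lM.
  rewrite !big_nil coef1 expr0n.
  by case: l {le_lM} => [|l] /=; rewrite ?mul0r // mul1r invr1 (rmorph1 iota).
rewrite !big_cons coefM addrC exprDn mulr_suml; apply: eq_bigr => j _.
have le_jl : (j <= l)%N by rewrite -ltnS.
rewrite IHr ?(leq_trans (leq_subr _ _)) // coef_poly ltnS (leq_trans le_jl) //.
rewrite -[X in _ = X * _]mulr_natr -(rmorph_nat iota).
have e : (j`!%:R)^-1 * ((l - j)`!%:R)^-1 = 'C(l, j)%:R * (l`!%:R)^-1 :> rat.
  rewrite -(bin_fact le_jl) !natrM; field.
  by rewrite !fact0 pnatr_eq0 -lt0n bin_gt0.
rewrite -[RHS]mulrA -rmorphM -e rmorphM /=; ring.
Qed.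

(** The multinomial theorem, by comparing coefficients in the product of exponentials. *)
Lemma expr_sum_fact (R : comNzRingType) (iota : {rmorphism rat -> R})
    (I : finType) (y : I -> R) (M l : nat) : (l <= M)%N ->
  (\sum_i y i) ^+ l * iota (l`!%:R)^-1
    = \sum_(mu : {ffun I -> 'I_M.+1} | (\sum_i mu i == l)%N)
        \prod_i (y i ^+ mu i * iota ((mu i)`!%:R)^-1).
Proof.
move=> le_lM; rewrite -(coef_prod_exp iota _ y le_lM).
exact: (coef_prod_poly M.+1 l (fun i k => y i ^+ k * iota (k`!%:R)^-1)).
Qed.

Lemma coef_poly_exp (A : comAlgType rat) (n : nat) (o : nat -> A) (l : nat) :
  (l <= n)%N ->
  (l`!%:R : rat)^-1 *: ((\poly_(i < n.+1) o i) ^+ l)`_n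
    = \sum_(mu : {ffun 'I_n.+1 -> 'I_n.+1} |
              (plength mu == l) && (\sum_(i < n.+1) i * mu i == n)%N)
        ((\prod_(i < n.+1) (mu i)`!)%:R : rat)^-1 *: \prod_(i < n.+1) o i ^+ mu i.
Proof.
move=> le_ln; pose iota : {rmorphism rat -> {poly A}} := polyC \o in_alg A.
have := congr1 (fun p : {poly A} => p`_n)
  (expr_sum_fact iota (fun i : 'I_n.+1 => o i *: 'X^i) le_ln).
rewrite /iota /= -poly_def mulrC coefCM mulr_algl => ->.
rewrite coef_sum [RHS]big_mkcondr /=; apply: eq_bigr => mu _.
have -> : \prod_(i < n.+1) ((o i *: 'X^i) ^+ mu i * (((mu i)`!%:R)^-1%:A)%:P)
    = (((\prod_(i < n.+1) (mu i)`!)%:R : rat)^-1 *: \prod_(i < n.+1) o i ^+ mu i)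
        *: 'X^(\sum_(i < n.+1) i * mu i)%N.
  rewrite expr_sum natr_prod -prodfV -scaler_prod -scaler_prod.
  apply: eq_bigr => i _; rewrite exprZn -exprM mulrC mul_polyC scalerA.
  by rewrite mulr_algl.
by rewrite coefZ coefXn eq_sym; case: eqP; rewrite ?mulr1 ?mulr0.
Qed.

Lemma psum_shift (n k : nat) : psum n k \mPo shift_subst n = odd_psum n k.
Proof.
rewrite /odd_psum /psum rmorph_sum /=.
under eq_bigr => i ik do rewrite comp_mpolyXU -tnth_nth tnth_mktuple.
case: ifP => ok.
  rewrite -sumrMnl; apply: eq_bigr => i /eqP ik.
  by rewrite ik ok scaler_nat.
by rewrite big1 // => i /eqP ik; rewrite ik ok.
Qed.

(** The identity (n+1) chi(s) = (n+1)^(number of cycles) gives each cycle one factor n+1. *)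
Lemma SH_cycle_index (n : nat) :
  SH n = (n.+1%:R : rat)^-1 *: cycle_index (fun k => (n.+1%:R : rat) *: odd_psum n k) n.
Proof.
rewrite /SH /PF comp_mpolyZ /cycle_index !scalerA mulrC -scalerA; congr (_ *: _).
rewrite rmorph_sum scaler_sumr; apply: eq_bigr => s _ /=.
rewrite comp_mpolyZ scaler_prod prodr_const scalerA -pf_char_porbits.
rewrite mulrCA mulVf ?pnatr_eq0 // mulr1; congr (_ *: _).
rewrite rmorph_prod; apply: eq_bigr => C _; exact: psum_shift.
Qed.

Theorem theorem3p4 (n : nat) (P : nat -> {mpoly rat[n]}) :
  (1 <= n)%N -> is_schurP_family P ->
  SH n = \sum_(mu : {ffun 'I_n.+1 -> 'I_n.+1} | odd_partition_mult mu)
           coef_lam mu *: Vlam P mu.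
Proof.
move=> n_gt0 HP.
pose q := cycle_index (odd_psum n).
rewrite SH_cycle_index.
rewrite (@odd_exponential _ n (odd_psum n) q
   (cycle_index (fun k => (n.+1%:R : rat) *: odd_psum n k)) n.+1%:R); first last.
- by move=> m _; apply: cycle_index_rec.
- exact: cycle_index0.
- by move=> m _; apply: cycle_index_rec.
- exact: cycle_index0.
- by move=> k /negbTE ok; rewrite /odd_psum ok.
pose o k := if odd k then q k else 0.
have fact0 m : (m`!%:R : rat) != 0 by rewrite pnatr_eq0 -lt0n fact_gt0.
have expand (l : 'I_n.+1) : asinh_coef n.+1%:R l *: ((\poly_(i < n.+1) o i) ^+ l)`_n
  = \sum_(mu : {ffun 'I_n.+1 -> 'I_n.+1} |
              (plength mu == l) && (\sum_(i < n.+1) i * mu i == n)%N)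
        (asinh_coef n.+1%:R l * l`!%:R / (\prod_(i < n.+1) (mu i)`!)%:R)
          *: \prod_(i < n.+1) o i ^+ mu i.
  have le_ln : (l <= n)%N by rewrite -ltnS.
  rewrite -[asinh_coef _ _ in LHS](mulfK (fact0 l)) -scalerA coef_poly_exp //.
  by rewrite scaler_sumr; apply: eq_bigr => mu _; rewrite scalerA.
under eq_bigr do rewrite expand.
(* Index 0 is even, so all parts are positive and the length lies between 1 and n; [inord] then
   records it faithfully. *)
have plength_le (mu : {ffun 'I_n.+1 -> 'I_n.+1}) :
    odd_partition_mult mu -> (0 < plength mu < n.+1)%N.
  move=> /andP[/forallP mu_odd /eqP sum_mu].
  apply/andP; split.
    rewrite lt0n; apply/eqP => l0.
    have : (0 < \sum_(i < n.+1) i * mu i)%N by rewrite sum_mu.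
    rewrite big1 // => i _.
    have : (mu i <= plength mu)%N by rewrite /plength (bigD1 i) //= leq_addr.
    by rewrite l0 leqn0 => /eqP ->; rewrite muln0.
  suff : (plength mu <= \sum_(i < n.+1) i * mu i)%N by rewrite sum_mu.
  apply: leq_sum => i _.
  case: (posnP i) => [i0|i_gt0]; last by rewrite leq_pmull.
  by have := mu_odd i; rewrite i0 => /eqP ->.
rewrite [RHS](partition_big (fun mu => inord (plength mu) : 'I_n.+1) predT) //=.
rewrite scaler_sumr; apply: eq_bigr => l _; rewrite scaler_sumr.
rewrite big_mkcond [RHS]big_mkcond /=; apply: eq_bigr => mu _.
(* A multiplicity vector using an even index contributes zero, since [o] vanishes there. *)
have [odd_mu|] := boolP (odd_partition_mult mu); last first.
  rewrite /= /odd_partition_mult; case: (_ == n)%N; rewrite ?andbF //= !andbT.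
  rewrite negb_forall => /existsP[i]; rewrite negb_imply => /andP[even_i mu_i].
  case: ifP => // _; rewrite [X in _ *: (_ *: X)](bigD1 i) //= /o (negbTE even_i).
  by rewrite expr0n (negbTE mu_i) mul0r !scaler0.
have /andP[l_gt0 l_lt] := plength_le mu odd_mu.
have /andP[/forallP mu_odd sum_mu] := odd_mu.
rewrite sum_mu andbT -val_eqE /= inordK //; case: eqP => // <-.
(* Each part brings a factor 2 because [o k] is 2 P_k for odd [k]. *)
have -> : \prod_(i < n.+1) o i ^+ mu i = 2%:R ^+ plength mu *: Vlam P mu.
  rewrite /Vlam /plength expr_sum -scaler_prod; apply: eq_bigr => i _.
  have := mu_odd i; rewrite /o; case oi: (odd i); last first.
    by move=> /= /eqP ->; rewrite !expr0 scale1r.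
  move=> _.
  rewrite -exprZn scaler_nat (schurP_cycle_index HP) //.
  by rewrite (odd_gt0 oi) -ltnS ltn_ord.
rewrite !scalerA /coef_lam; congr (_ *: _).
(* The leading factor a = n+1 cancels the prefactor 1/(n+1), and a + l' - 1 equals n + l - 1 for l =
   l' + 1. *)
case: (plength mu) l_gt0 => // l' _; rewrite /asinh_coef succnK.
rewrite (eq_bigr (fun j : 'I_l' => (n + l'.+1)%:R - 1 - 2%:R * j%:R)) => [|j _].
  have := fact0 l'.+1; move: (l'.+1`!%:R : rat) (\prod_(j < l') _) => F Q F0.
  have N0 : (n.+1%:R : rat) != 0 by rewrite pnatr_eq0.
  have : ((\prod_(i < n.+1) (mu i)`!)%:R : rat) != 0.
    by rewrite natr_prod; apply/prodf_neq0 => i _.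
  move: ((\prod_(i < n.+1) (mu i)`!)%:R : rat) (n.+1%:R : rat) N0 => D N N0 D0.
  by field; rewrite ?F0 ?N0 ?D0.
by rewrite natrD -!natr1; ring.
Qed.
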